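(* Let $k\ge 2$ be any integer and let $\mathcal{F}(k)$ be the family of all graphs on at most $k$ vertices. Then for every $p\ge k+2$ we have $f(n,K_p|\mathcal{F}(k))=(1+o(1))\,\mathrm{ex}(n,K_{p-k+1})$ as $n\to\infty$.
   Context: $\mathrm{ex}(n,F)$ is the Turán number: the maximum number of edges in a graph of order $n$ containing no subgraph isomorphic to $F$. In an edge coloring of $K_n$ (not necessarily proper), for a copy $G'\subseteq K_n$ of a graph $G$, a color class of $G'$ is the graph (without isolated vertices) formed by all edges of $G'$ having a given color that occurs in $G'$. For a family $\mathcal{F}$ of graphs (closed under isomorphism) with $K_2\in\mathcal{F}$, and $n\ge |G|$, $f(n,G|\mathcal{F})$ is the smallest integer $m$ such that in every edge coloring of $K_n$ using at least $m$ colors there exists a copy of $G$ in which all color classes are members of $\mathcal{F}$. *)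

(* Defs.v *)
From HB Require Import structures.
From mathcomp Require Import all_boot all_order all_algebra.
From mathcomp Require Import boolp.

Set Implicit Arguments.
Unset Strict Implicit.
Unset Printing Implicit Defensive.

(** Finite simple graphs, with edges as two-element vertex sets. *)
Record sgraph := SGraph {
  vertex :> finType;
  edges : {set {set vertex}};
  edges_card2 : {in edges, forall e : {set vertex}, #|e| = 2} }.

Definition pairs (T : finType) : {set {set T}} := [set e : {set T} | #|e| == 2].

Fact pairs_card2 (T : finType) : {in pairs T, forall e : {set T}, #|e| = 2}.
Proof. by move=> e; rewrite inE => /eqP. Qed.

Definition complete_graph (n : nat) : sgraph :=
  @SGraph 'I_n (pairs 'I_n) (@pairs_card2 'I_n).

Section SpannedGraph.
Variables (T : finType) (E : {set {set T}}).
Let V : finType := {x : T | x \in cover E}.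
Let EV : {set {set V}} := [set e : {set V} | (val @: e \in E) && (#|e| == 2)].

Fact spanned_card2 : {in EV, forall e : {set V}, #|e| = 2}.
Proof. by move=> e; rewrite inE => /andP[_ /eqP]. Qed.

(** The graph without isolated vertices whose edges are those of [E], for [E] a
    set of two-element sets. *)
Definition spanned_graph : sgraph := SGraph spanned_card2.
End SpannedGraph.

(** Edge set of the image of [G] under the vertex map [h]; for injective [h]
    this is a copy of [G]. *)
Definition copy_edges (G : sgraph) (T : finType) (h : G -> T) : {set {set T}} :=
  [set h @: e | e : {set G} in edges G].

Definition contains_copy (T : finType) (E : {set {set T}}) (G : sgraph) : bool :=
  [exists h : {ffun G -> T}, injectiveb h && (copy_edges h \subset E)].

(** The Turan number; graphs of order [n] are taken on the vertex set ['I_n]. *)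
Definition turan (n : nat) (F : sgraph) : nat :=
  \max_(E : {set {set 'I_n}} | (E \subset pairs 'I_n) && ~~ contains_copy E F)
     #|E|.

(** An edge coloring of [K_n] is a map [c : {set 'I_n} -> nat], of which only
    the values on [pairs 'I_n] matter. *)
Definition num_colors (n : nat) (c : {set 'I_n} -> nat) : nat :=
  size (undup [seq c e | e in pairs 'I_n]).

Definition color_class (n : nat) (c : {set 'I_n} -> nat)
    (E : {set {set 'I_n}}) (a : nat) : sgraph :=
  spanned_graph [set e in E | c e == a].

Definition forces_copy (n : nat) (G : sgraph) (F : sgraph -> Prop) (m : nat) :
    Prop :=
  forall c : {set 'I_n} -> nat, m <= num_colors c ->
    exists2 h : G -> 'I_n, injective h &
      forall e0, e0 \in copy_edges h -> F (color_class c (copy_edges h) (c e0)).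

Fact forces_copy_exists (n : nat) (G : sgraph) (F : sgraph -> Prop) :
  exists m, `[< forces_copy n G F m >].
Proof.
exists #|pairs 'I_n|.+1; apply/asboolP => c /leq_trans/(_ (size_undup _)).
by rewrite size_image ltnn.
Qed.

(** [f(n, G | F)]. Some [m] always qualifies, vacuously when it exceeds the
    number of edges of [K_n], so the minimum needs no hypothesis on [n], [G]
    and [F]. *)
Definition color_number (n : nat) (G : sgraph) (F : sgraph -> Prop) : nat :=
  ex_minn (forces_copy_exists n G F).

Definition at_most_vertices (k : nat) (H : sgraph) : Prop := #|H| <= k.

(* Main.v *)
Require Import Defs.
From mathcomp Require Import all_boot all_order all_algebra.
From mathcomp Require Import all_classical all_reals all_analysis.
From mathcomp Require Import fintype finset zify.

(** Write [q = p - k >= 2], so that the Turan number at stake is that of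
    [K_(q+1)].

    Lower bound.  Give the edges of a [K_(q+1)]-free graph pairwise different
    colours and all other edges one further colour, 0.  If the colour 0 spans
    at most [k] vertices of a copy of [K_p], then the [q] or more remaining
    vertices, together with any one further vertex, form a clique of the graph.
    Hence no copy is good, and the colour number exceeds the Turan number
    ([turan_lt_color_number]).

    Upper bound.  Suppose that at least [turan n + n^2 / s] colours occur, and
    let [E] consist of one representative edge of each colour.  It suffices to
    find a map [f] from [k + q] points to the vertices that is a copy of the
    complete multipartite graph with parts [k, 1, .., 1] in [E], and such that
    [f l] never lies on the representative of the colour of [{f i, f j}] for
    distinct [i], [j], [l]: every edge between parts is then the only edge of
    its colour in the copy, and what remains lives on the [k] vertices of the
    large part ([generic_blowup_copy]).  The second condition excludes only
    [O(n^(k+q-1))] maps ([card_nongeneric]), so it is enough that [E] contains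
    [c n^(k+q)] copies of the multipartite graph, for a constant [c > 0].

    These copies come from supersaturation, by averaging over all maps [f] from
    [m] points to the vertices, injective or not.  The graph pulled back along
    [f] has on average ['C(m, 2) * 2 |E| / n^2] edges ([sum_card_pullback]),
    and it is [K_(q+1)]-free whenever [E] is.  Applied to extremal graphs this
    gives [2 turan n / n^2 <= turan m / 'C(m, 2)] for all [m] and [n]
    ([turan_density]).  Hence, when [|E| >= turan n + n^2 / s], the average for
    [m] of order [s] exceeds [turan m] by at least 1 as soon as [n >= m], so a
    positive fraction of all maps pull back a [K_(q+1)], and [E] contains
    [c n^(q+1)] cliques ([many_cliques]).  A power-mean argument then replaces
    one vertex of the cliques by [k] vertices ([blowup_count]).

    The error [n^2 / s] is negligible because the Turan number of [K_(q+1)] is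
    quadratic for [q >= 2], which is again [turan_density], with one of the two
    orders equal to 2 ([turan_quadratic]). *)

Set Implicit Arguments.
Unset Strict Implicit.
Unset Printing Implicit Defensive.

(** * Counting finite functions *)

(** Every function on the subset [h] of the domain has the same number of
    extensions, so a condition that only sees [h] holds with the same
    frequency on both domains. *)
Lemma card_ffun_restrict (I J V : finType) (h : J -> I) (P : pred {ffun J -> V}) :
  injective h ->
  #|[set f : {ffun I -> V} | P [ffun j => f (h j)]]|
    = #|[set g | P g]| * #|V| ^ (#|I| - #|J|).
Proof.
move=> inj_h; rewrite -sum1_card.
rewrite (partition_big (fun f : {ffun I -> V} => [ffun j => f (h j)])
           (mem [set g | P g])) /=; last by move=> f; rewrite !inE.
rewrite -sum_nat_const; apply: eq_bigr => g; rewrite inE => Pg.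
(* The functions restricting to [g]: values are prescribed on the image of [h]
   and free elsewhere. *)
pose F i := if [pick j | h j == i] is Some j then pred1 (g j) else predT.
have -> : \sum_(f : {ffun I -> V} | (f \in [set f : {ffun I -> V} | P [ffun j => f (h j)]])
    && ([ffun j => f (h j)] == g)) 1 = #|family F|.
  rewrite -sum1_card; apply: eq_bigl => f; rewrite !inE.
  apply/andP/familyP => [[_ /eqP fg] i | Ff].
    rewrite /F; case: pickP => [j /eqP <-|//]; by rewrite inE -fg ffunE.
  have fg : [ffun j => f (h j)] = g.
    apply/ffunP=> j; rewrite ffunE; have := Ff (h j); rewrite /F.
    by case: pickP => [j' /eqP/inj_h ->|/(_ j)/eqP//]; rewrite inE => /eqP.
  by rewrite fg Pg eqxx.
rewrite card_family foldrE big_map big_enum /=.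
rewrite (bigID (mem (codom h))) /= big1 ?mul1n => [|i /codomP[j ->]]; last first.
  by rewrite /F; case: pickP => [j' _|/(_ j)/eqP//]; rewrite card1.
rewrite (eq_bigr (fun=> #|V|)) => [|i i_h]; last first.
  rewrite /F; case: pickP => [j /eqP hj|_]; last by apply: eq_card.
  by rewrite -hj codom_f in i_h.
rewrite prod_nat_const -(card_codom inj_h) -(cardC (mem (codom h))) addKn.
by congr (_ ^ _); apply: eq_card.
Qed.

Lemma card_ffun_option (J V : finType) (Q : V -> {ffun J -> V} -> bool) :
  #|[set f : {ffun option J -> V} | Q (f None) [ffun j => f (Some j)]]|
    = \sum_g #|[set v | Q v g]|.
Proof.
rewrite -sum1_card (partition_big
  (fun f : {ffun option J -> V} => [ffun j => f (Some j)]) predT) //=.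
apply: eq_bigr => g _; rewrite sum1_card.
pose ext v : {ffun option J -> V} := [ffun o => if o is Some j then g j else v].
have ext_inj : injective ext.
  by move=> v w /ffunP/(_ None); rewrite !ffunE.
have res_ext v : [ffun j => ext v (Some j)] = g by apply/ffunP=> j; rewrite !ffunE.
rewrite -(card_imset _ ext_inj); apply: eq_card => f; rewrite unfold_in /= inE.
apply/andP/imsetP => [[Qf /eqP fg] | [v]].
  exists (f None); first by rewrite inE -[in X in Q _ X]fg.
  by apply/ffunP=> -[j|]; rewrite !ffunE // -fg ffunE.
by rewrite inE => Qv ->; rewrite res_ext ffunE.
Qed.

Lemma card_arcs (V : finType) (E : {set {set V}}) : E \subset pairs V ->
  #|[set g : {ffun bool -> V} | [set g true; g false] \in E]| = 2 * #|E|.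
Proof.
move=> /subsetP sE; rewrite -sum1_card.
rewrite (partition_big (fun g : {ffun bool -> V} => [set g true; g false])
           (mem E)) /=; last by move=> f; rewrite !inE.
rewrite mulnC -sum_nat_const; apply: eq_bigr => e eE; rewrite sum1_card.
have := sE e eE; rewrite inE => /cards2P[x [y [xy def_e]]].
pose g1 : {ffun bool -> V} := [ffun b => if b then x else y].
pose g2 : {ffun bool -> V} := [ffun b => if b then y else x].
have g12 : g1 != g2 by apply: contraNneq xy => /ffunP/(_ true); rewrite !ffunE => ->.
have -> : 2 = #|[set g1; g2]| by rewrite cards2 g12.
apply: eq_card => g; rewrite unfold_in /= !inE.
apply/andP/orP => [[_ /eqP ge] | g_eq]; last first.
  have ge : [set g true; g false] = e.
    by case: g_eq => /eqP->; rewrite !ffunE // def_e // setUC.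
  by rewrite ge eqxx.
have gx : x \in [set g true; g false] by rewrite ge def_e !inE eqxx.
have gy : y \in [set g true; g false] by rewrite ge def_e !inE eqxx orbT.
move: gx gy; rewrite !inE.
move=> /orP[]/eqP xg /orP[]/eqP yg; try by rewrite xg yg eqxx in xy.
  by left; apply/eqP/ffunP=> -[]; rewrite ffunE.
by right; apply/eqP/ffunP=> -[]; rewrite ffunE.
Qed.

(** * Sampling a graph along all maps *)

Definition pullback (I V : finType) (E : {set {set V}}) (f : I -> V) :
  {set {set I}} := [set e in pairs I | f @: e \in E].

Lemma imset_pair (I V : finType) (f : I -> V) x y :
  f @: [set x; y] = [set f x; f y].
Proof. by rewrite imsetU1 imset_set1. Qed.

(** Each of the ['C(m, 2)] pairs of points is sent to an edge by the same number
    of maps, as its two ends are sent to any of the [2 |E|] arcs and the other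
    [m - 2] points anywhere. *)
Lemma sum_card_pullback (m : nat) (V : finType) (E : {set {set V}}) :
  E \subset pairs V ->
  \sum_(f : {ffun 'I_m -> V}) #|pullback E f|
    = 'C(m, 2) * (2 * #|E| * #|V| ^ (m - 2)).
Proof.
move=> sE; under eq_bigr => f _ do rewrite -sum1dep_card.
rewrite (exchange_big_dep (mem (pairs 'I_m))) /=; last first.
  by move=> f e _ /andP[].
have <- : #|pairs 'I_m| = 'C(m, 2) by rewrite card_draws card_ord.
rewrite -sum_nat_const; apply: eq_bigr => e epair.
have := epair; rewrite inE => /cards2P[x [y [xy def_e]]].
rewrite -(card_arcs sE).
pose h (b : bool) := if b then x else y.
have inj_h : injective h.
  by move=> [] [] //= /eqP; rewrite ?(negPf xy) // eq_sym (negPf xy).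
have := card_ffun_restrict 
  (fun g : {ffun bool -> V} => [set g true; g false] \in E) inj_h.
rewrite card_ord card_bool => <-; rewrite sum1_card; apply: eq_card => f.
have e2 : #|e| == 2 by move: epair; rewrite inE.
by rewrite unfold_in /= !inE e2 !ffunE /= def_e imset_pair.
Qed.

(** * Cliques and Turan numbers *)

(** Homomorphisms from the complete graph on [J]; they are easier to compose and
    to count than copies of a [complete_graph]. *)
Definition clique_map (V : finType) (E : {set {set V}}) (J : finType)
    (f : J -> V) : bool :=
  [forall i, forall j, (i != j) ==> ([set f i; f j] \in E)].

Lemma clique_mapP (V J : finType) (E : {set {set V}}) (f : J -> V) :
  reflect (forall i j, i != j -> [set f i; f j] \in E) (clique_map E f).
Proof.
apply: (iffP forallP) => [cl i j ij | cl i].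
  by have /forallP/(_ j)/implyP := cl i; apply.
by apply/forallP=> j; apply/implyP/cl.
Qed.

Lemma clique_map_comp (V I J : finType) (E : {set {set V}}) (f : J -> V)
    (h : I -> J) :
  injective h -> clique_map E f -> clique_map E (fun i => f (h i)).
Proof.
move=> inj_h /clique_mapP cl; apply/clique_mapP=> i j ij; apply: cl.
by rewrite (inj_eq inj_h).
Qed.

Lemma clique_map_inj (V J : finType) (E : {set {set V}}) (f : J -> V) :
  E \subset pairs V -> clique_map E f -> injective f.
Proof.
move=> /subsetP sE /clique_mapP cl i j fij; apply/eqP; apply: contraT => ij.
have := sE _ (cl _ _ ij); rewrite inE fij setUid cards1; by [].
Qed.

Lemma clique_map_copy (V J : finType) (E : {set {set V}}) (f : J -> V) (r : nat) :
  E \subset pairs V -> r <= #|J| -> clique_map E f ->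
  contains_copy E (complete_graph r).
Proof.
move=> sE rJ cl.
pose h (i : 'I_r) : J := enum_val (widen_ord rJ i).
have inj_h : injective h by move=> i j /enum_val_inj [] /val_inj.
have clh := clique_map_comp inj_h cl.
apply/existsP; exists [ffun i => f (h i)]; apply/andP; split.
  apply/injectiveP=> i j; rewrite !ffunE; exact: (clique_map_inj sE clh).
apply/subsetP=> _ /imsetP[e epair ->].
move: epair; rewrite inE => /cards2P[x [y [xy ->]]].
by rewrite imset_pair !ffunE; move/clique_mapP: clh; apply.
Qed.

Lemma copy_clique_map (V : finType) (E : {set {set V}}) (r : nat) :
  contains_copy E (complete_graph r) ->
  exists f : {ffun 'I_r -> V}, clique_map E f.
Proof.
case/existsP=> f /andP[_ /subsetP sub]; exists f; apply/clique_mapP=> i j ij.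
rewrite -imset_pair; apply: sub; apply/imsetP; exists [set i; j] => //.
by rewrite inE cards2 ij.
Qed.

(** Points that [f] identifies are not adjacent in the pullback, whence a clique
    of the pullback is mapped injectively onto a clique of [E]. *)
Lemma copy_pullback (m : nat) (V : finType) (E : {set {set V}}) (f : 'I_m -> V) r :
  E \subset pairs V -> contains_copy (pullback E f) (complete_graph r) ->
  contains_copy E (complete_graph r).
Proof.
move=> sE /copy_clique_map[g /clique_mapP cl].
apply: (clique_map_copy (f := fun i => f (g i))) => //; first by rewrite card_ord.
apply/clique_mapP=> i j ij; move: (cl i j ij).
by rewrite inE imset_pair => /andP[].
Qed.

Lemma pullback_pairs (I V : finType) (E : {set {set V}}) (f : I -> V) :
  pullback E f \subset pairs I.
Proof. by apply/subsetP=> e; rewrite inE => /andP[]. Qed.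

Lemma leq_turan (n : nat) (E : {set {set 'I_n}}) (F : sgraph) :
  E \subset pairs 'I_n -> ~~ contains_copy E F -> #|E| <= turan n F.
Proof.
move=> sE free; apply: (leq_bigmax_cond (F := fun E : {set {set 'I_n}} => #|E|)).
by rewrite sE.
Qed.

Lemma turan_attained (n r : nat) : 2 <= r ->
  exists E : {set {set 'I_n}}, [/\ E \subset pairs 'I_n,
    ~~ contains_copy E (complete_graph r) & #|E| = turan n (complete_graph r)].
Proof.
move=> r2; pose P (E : {set {set 'I_n}}) :=
  (E \subset pairs 'I_n) && ~~ contains_copy E (complete_graph r).
have P0 : P set0.
  rewrite /P sub0set; apply/negP=> /copy_clique_map[f /clique_mapP cl].
  by have := cl (Ordinal (ltnW r2)) (Ordinal r2) isT; rewrite inE.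
have nzP : 0 < #|P| by apply/card_gt0P; exists set0.
have [E /andP[sE fE] maxE] :=
  eq_bigmax_cond (fun E : {set {set 'I_n}} => #|E|) nzP.
by exists E; split=> //; rewrite -maxE.
Qed.

Lemma turan_leq_bin (m : nat) (F : sgraph) : turan m F <= 'C(m, 2).
Proof.
have <- : #|pairs 'I_m| = 'C(m, 2) by rewrite card_draws card_ord.
by apply/bigmax_leqP=> E /andP[sE _]; apply: subset_leq_card.
Qed.

(** A quantitative form of the convergence of the Turan densities, which holds
    because the average over [f] of [#|pullback E f|], for [E] extremal of
    order [n], is at most [turan m]. *)
Lemma turan_density (m n r : nat) : 2 <= m -> 2 <= r -> 0 < n ->
  'C(m, 2) * (2 * turan n (complete_graph r))
    <= turan m (complete_graph r) * n ^ 2.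
Proof.
move=> m2 r2 n0; have [E [sE fE <-]] := turan_attained n r2.
rewrite -(@leq_pmul2r (n ^ (m - 2))) ?expn_gt0 ?n0 //.
rewrite -[leqRHS]mulnA -expnD subnKC // -[leqLHS]mulnA.
have := sum_card_pullback m sE; rewrite card_ord => <-.
have -> : n ^ m = #|{ffun 'I_m -> 'I_n}| by rewrite card_ffun !card_ord.
rewrite mulnC -sum_nat_const; apply: leq_sum => f _.
apply: leq_turan; first exact: pullback_pairs.
by apply: contra fE; apply: copy_pullback.
Qed.

(** * Supersaturation *)

Lemma card_union_bound (T I : finType) (A : {set T}) (P : pred I)
    (B : I -> {set T}) (b : nat) :
  (forall x, x \in A -> exists2 i, P i & x \in B i) ->
  (forall i, P i -> #|B i| <= b) -> #|A| <= #|I| * b.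
Proof.
move=> covA leB.
have sA : A \subset \bigcup_(i | P i) B i.
  by apply/subsetP=> x /covA[i Pi Bx]; apply/bigcupP; exists i.
apply: leq_trans (subset_leq_card sA) _.
have /leq_trans -> // : #|\bigcup_(i | P i) B i| <= \sum_(i | P i) b.
  elim/big_rec2: _ => [|i c X Pi leX]; first by rewrite cards0.
  by apply: leq_trans (leq_card_setU _ _) _; apply: leq_add; first exact: leB.
by rewrite sum_nat_const leq_mul2r max_card orbT.
Qed.

(** With [t] and [K] the Turan numbers of orders [n] and [m], and [e] the number
    of edges of a graph of order [n], the conclusion says that the average
    number of edges of a pullback to [m] points is at least [K + 1].  Up to
    the factors [1 - 1 / m] and [1 - 1 / n], the contribution of [t] is [K]; the
    loss is at most [K / m + K / n <= m], and the gain is at least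
    [m (m - 1) / s >= 2 m]. *)
Lemma sampling_arith (s m n e t K : nat) :
  2 * s < m -> m <= n -> s * t + n ^ 2 <= s * e ->
  n * n.-1 * K <= t * m ^ 2 -> 2 * K <= m ^ 2 ->
  K.+1 * n ^ 2 <= m * m.-1 * e.
Proof.
case: m => // a; case: n => // b; rewrite /= !expnS !expn0 !muln1 => sa ab he hK K2.
case: s => [|s'] in sa he *; first by move: he; rewrite !mul0n.
set s := s'.+1 in sa he *.
rewrite -(@leq_pmul2l (s * a.+1)) //.
have h1 : a * a.+1 * a.+1 * (s * t + b.+1 * b.+1) <= a * a.+1 * a.+1 * (s * e).
  by rewrite leq_mul2l he orbT.
have h2 : a * s * (b.+1 * b * K) <= a * s * (t * (a.+1 * a.+1)).
  by rewrite leq_mul2l hK orbT.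
have h3 : s * (b.+1 * b.+1) * (2 * K) <= s * (b.+1 * b.+1) * (a.+1 * a.+1).
  by rewrite leq_mul2l K2 orbT.
have h4 : s * b.+1 * K * (a + b + 1) <= s * b.+1 * K * (2 * b.+1).
  by rewrite leq_mul2l; apply/orP; right; lia.
have h5 : a.+1 * (b.+1 * b.+1) * (2 * s * a.+1) <= a.+1 * (b.+1 * b.+1) * (a * a.+1).
  by rewrite leq_mul2l; apply/orP; right; rewrite leq_mul2r; apply/orP; right; lia.
have h6 : s * (a.+1 * (b.+1 * b.+1)) <= s * (a.+1 * (b.+1 * b.+1)) * a.+1.
  by rewrite leq_pmulr.
lia.
Qed.

(** A sampled map either pulls back at most [turan m] edges or pulls back a
    clique; as the average is at least [turan m + 1] and no pullback has more
    than [m ^ 2] edges, a fraction [1 / m ^ 2] of the maps pulls back a clique.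
    Some injection of the [q + 1] vertices among the [m] points realizes it. *)
Lemma many_cliques (s m n q : nat) (E : {set {set 'I_n}}) :
  2 * s < m -> q < m -> 0 < q -> m <= n -> E \subset pairs 'I_n ->
  s * turan n (complete_graph q.+1) + n ^ 2 <= s * #|E| ->
  n ^ q.+1 <= m ^ q.+3 *
    #|[set f : {ffun option 'I_q -> 'I_n} | clique_map E f]|.
Proof.
move=> sm qm q0 mn sE dense.
have m2 : 2 <= m by apply: leq_trans qm.
have n0 : 0 < n by apply: leq_trans mn; apply: leq_trans m2.
set K := turan m (complete_graph q.+1).
set H := #|_|.
have binm a : 'C(a, 2) * 2 = a * a.-1 by rewrite mulnC -mul_bin_diag bin1.
have avg : K.+1 * n ^ 2 <= m * m.-1 * #|E|.
  apply: (sampling_arith sm mn dense).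
    rewrite -(binm n) -mulnA /K; exact: (@turan_density n m q.+1 (leq_trans m2 mn) q0 (ltnW m2)).
  have := turan_leq_bin m (complete_graph q.+1); rewrite -/K => leK.
  rewrite mulnC (leq_trans (n := 'C(m, 2) * 2)) ?leq_mul2r ?leK ?orbT //.
  by rewrite binm leq_mul2l leq_pred orbT.
pose C := [set f : {ffun 'I_m -> 'I_n} |
             contains_copy (pullback E f) (complete_graph q.+1)].
have cardF : #|{ffun 'I_m -> 'I_n}| = n ^ m by rewrite card_ffun !card_ord.
have le1 : n ^ m <= m ^ 2 * #|C|.
  rewrite -(leq_add2l (K * n ^ m)) -mulSnr.
  have -> : n ^ m = n ^ 2 * n ^ (m - 2) by rewrite -expnD subnKC.
  rewrite mulnA (leq_trans (n := m * m.-1 * #|E| * n ^ (m - 2))) //.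
    by rewrite leq_mul2r avg orbT.
  rewrite -binm -2!mulnA [2 * _]mulnA.
  have := sum_card_pullback m sE; rewrite card_ord => <-.
  rewrite -expnD subnKC //.
  rewrite -cardF mulnC -sum_nat_const [m ^ 2 * _]mulnC -sum_nat_const.
  rewrite [X in _ <= _ + X]big_mkcond -big_split /=; apply: leq_sum => f _.
  rewrite inE; case: ifP => [_|/negbT free]; last first.
    by rewrite addn0; apply: leq_turan => //; apply: pullback_pairs.
  apply: leq_trans (leq_addl _ _).
  apply: leq_trans (subset_leq_card (pullback_pairs E f)) _.
  rewrite card_draws card_ord -(@leq_pmul2r 2) // binm.
  by rewrite (leq_trans (n := m * m)) ?leq_mul2l ?leq_pred ?orbT // leq_pmulr.
have le2 : #|C| <= m ^ q.+1 * (H * n ^ (m - q.+1)).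
  have <- : #|{ffun option 'I_q -> 'I_m}| = m ^ q.+1.
    by rewrite card_ffun card_option !card_ord.
  apply: (@card_union_bound _ _ C (fun h : {ffun option 'I_q -> 'I_m} => injectiveb h)
    (fun h : {ffun option 'I_q -> 'I_m} =>
      [set f : {ffun 'I_m -> 'I_n} | clique_map E [ffun j => f (h j)]])) => [f | h].
    rewrite inE => /copy_clique_map[g clg].
    have qE : #|{: option 'I_q}| = q.+1 by rewrite card_option card_ord.
    pose u (i : option 'I_q) := cast_ord qE (enum_rank i).
    have inj_u : injective u by move=> i j /cast_ord_inj/enum_rank_inj.
    exists [ffun i => g (u i)].
      apply/injectiveP=> i j; rewrite !ffunE => /(clique_map_inj (pullback_pairs E f) clg).
      exact: inj_u.
    rewrite inE; apply/clique_mapP=> i j ij; rewrite !ffunE.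
    have /clique_mapP/(_ (u i) (u j)) := clg.
    by rewrite (inj_eq inj_u) inE imset_pair => /(_ ij)/andP[].
  move/injectiveP=> inj_h.
  have := card_ffun_restrict (fun g : {ffun option 'I_q -> 'I_n} => clique_map E g) inj_h.
  by rewrite card_option !card_ord => ->.
have := leq_trans le1 (leq_mul (leqnn (m ^ 2)) le2).
have -> : n ^ m = n ^ q.+1 * n ^ (m - q.+1) by rewrite -expnD subnKC.
by rewrite !mulnA leq_pmul2r ?expn_gt0 ?n0 // -expnD add2n.
Qed.

(** Homomorphisms from the complete multipartite graph with parts of sizes
    [k, 1, .., 1]; the part of size [k] is ['I_k], the other [q] are the points
    of ['I_q]. *)
Definition blowup_map (V : finType) (E : {set {set V}}) (k q : nat)
    (f : {ffun 'I_k + 'I_q -> V}) : bool :=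
  clique_map E (fun b => f (inr b)) &&
  [forall a, forall b, [set f (inl a); f (inr b)] \in E].

(** Let [D g] be the set of common extensions of a [q]-clique [g].  Cliques with
    [q + 1] vertices number [\sum_g #|D g|], and blow-ups [\sum_g #|D g| ^ k].
    Only those [g] with [#|D g|] at least half of the guaranteed average matter,
    and for them [#|D g| ^ k] is bounded below linearly in [#|D g|]. *)
Lemma blowup_count (V : finType) (E : {set {set V}}) (k q M : nat) :
  0 < k -> 0 < #|V| ->
  #|V| ^ q.+1
    <= M * #|[set f : {ffun option 'I_q -> V} | clique_map E f]| ->
  #|V| ^ (k + q) <= (2 * M) ^ k *
    #|[set f : {ffun 'I_k + 'I_q -> V} | blowup_map E f]|.
Proof.
move=> k0 V0; set n := #|V| in V0 *.
pose Q v (g : {ffun 'I_q -> V}) :=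
  clique_map E g && [forall b, [set v; g b] \in E].
pose D g := [set v | Q v g].
have -> : [set f : {ffun option 'I_q -> V} | clique_map E f]
   = [set f : {ffun option 'I_q -> V} | Q (f None) [ffun j => f (Some j)]].
  apply/setP=> f; rewrite !inE; apply/clique_mapP/andP.
    move=> cl; split; last by apply/forallP=> b; rewrite ffunE; apply: cl.
    by apply/clique_mapP=> i j ij; rewrite !ffunE; apply: cl.
  case=> /clique_mapP cl /forallP clN [i|] [j|] //; rewrite ?ffunE.
  - by move=> ij; have := cl i j; rewrite !ffunE; apply.
  - by move=> _; have := clN i; rewrite ffunE setUC.
  - by move=> _; have := clN j; rewrite ffunE.
rewrite card_ffun_option -/D => dense.
set W := [set f | _].
have leW : \sum_g #|D g| ^ k <= #|W|.
  rewrite -[#|W|]sum1_card (partition_big (fun f : {ffun 'I_k + 'I_q -> V} =>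
     [ffun b => f (inr b)] : {ffun 'I_q -> V}) predT) //=.
  apply: leq_sum => g _; rewrite sum1_card.
  have -> : #|D g| ^ k = #|[set A : {ffun 'I_k -> V} | A \in ffun_on (mem (D g))]|.
    by rewrite -[in LHS](card_ord k) -card_ffun_on; apply: eq_card => A; rewrite inE.
  pose ext (A : {ffun 'I_k -> V}) : {ffun 'I_k + 'I_q -> V} :=
    [ffun i => match i with inl a => A a | inr b => g b end].
  have ext_inj : injective ext.
    move=> A A' eqA; apply/ffunP=> a.
    by move/ffunP/(_ (inl a)): eqA; rewrite !ffunE.
  rewrite -(card_imset _ ext_inj); apply: subset_leq_card.
  apply/subsetP=> _ /imsetP[A + ->]; rewrite inE => /ffun_onP onA.
  rewrite unfold_in /= inE; apply/andP; split; last first.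
    by apply/eqP/ffunP=> b; rewrite !ffunE.
  apply/andP; split.
    have := onA (Ordinal k0); rewrite inE => /andP[/clique_mapP cl _].
    by apply/clique_mapP=> i j ij; rewrite !ffunE; apply: cl.
  apply/forallP=> a; apply/forallP=> b; rewrite !ffunE.
  by have := onA a; rewrite inE => /andP[_ /forallP].
apply: leq_trans (leq_mul (leqnn _) leW).
case: k k0 {W leW} => // k _.
(* [x ^ (k + 1) >= n ^ k * (x - n)], trivially on either side of [x = n], the
   threshold at which [d] is half of [n / M]. *)
have pow d : n ^ k * (2 * M * d) <= (2 * M) ^ k.+1 * d ^ k.+1 + n ^ k.+1.
  rewrite -expnMn; set x := 2 * M * d.
  have [xn|nx] := leqP x n.
    by apply: leq_trans (leq_addl _ _); rewrite expnSr leq_mul2l xn orbT.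
  apply: leq_trans (leq_addr _ _); rewrite expnSr leq_mul2r.
  apply/orP; right; case: (k) => // k'; by rewrite leq_exp2r // ltnW.
have := leq_sum (P := predT) (index_enum _)
  (fun (g : {ffun 'I_q -> V}) (_ : true) => pow #|D g|).
rewrite -!big_distrr /= big_split /= -big_distrr /= sum_nat_const card_ffun card_ord.
rewrite -/n => le.
rewrite -(leq_add2r (n ^ q * n ^ k.+1)); apply: leq_trans le.
rewrite [n ^ q * _]mulnC -expnD addnn -mul2n -mulnA mulnCA leq_mul2l /=.
by rewrite addSnnS expnD leq_mul2l dense orbT.
Qed.

(** * Representatives of colours and generic maps *)

Definition rep_edge (n : nat) (c : {set 'I_n} -> nat) (a : nat) : {set 'I_n} :=
  odflt set0 [pick e in pairs 'I_n | c e == a].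

Definition rep_edges (n : nat) (c : {set 'I_n} -> nat) : {set {set 'I_n}} :=
  [set rep_edge c (c e) | e in pairs 'I_n].

Lemma rep_edge_spec (n : nat) (c : {set 'I_n} -> nat) e : e \in pairs 'I_n ->
  rep_edge c (c e) \in pairs 'I_n /\ c (rep_edge c (c e)) = c e.
Proof.
move=> eP; rewrite /rep_edge; case: pickP => [e' /andP[e'P /eqP ->] //|/(_ e)].
by rewrite eP eqxx.
Qed.

Lemma rep_edges_pairs (n : nat) (c : {set 'I_n} -> nat) :
  rep_edges c \subset pairs 'I_n.
Proof. by apply/subsetP=> _ /imsetP[e eP ->]; case: (rep_edge_spec c eP). Qed.

Lemma rep_edgesK (n : nat) (c : {set 'I_n} -> nat) e :
  e \in rep_edges c -> rep_edge c (c e) = e.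
Proof. by case/imsetP=> e' e'P ->; case: (rep_edge_spec c e'P) => _ ->. Qed.

Lemma card_rep_edge (n : nat) (c : {set 'I_n} -> nat) a : #|rep_edge c a| <= 2.
Proof.
rewrite /rep_edge; case: pickP => [e /andP[]|_]; last by rewrite cards0.
by rewrite inE => /eqP ->.
Qed.

Lemma leq_num_colors_rep (n : nat) (c : {set 'I_n} -> nat) :
  num_colors c <= #|rep_edges c|.
Proof.
rewrite /num_colors; set s := undup _.
have sP a : a \in s -> exists2 e, e \in pairs 'I_n & a = c e.
  by rewrite mem_undup => /imageP.
rewrite -(size_map (rep_edge c)) cardE; apply: uniq_leq_size.
  rewrite map_inj_in_uniq ?undup_uniq // => a b /sP[e eP ->] /sP[e' e'P ->] eq_rep.
  case: (rep_edge_spec c eP) => _ <-.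
  by rewrite eq_rep; case: (rep_edge_spec c e'P) => _ ->.
move=> _ /mapP[a /sP[e eP ->] ->]; rewrite mem_enum; exact: imset_f.
Qed.

(** The vertices that a third vertex of a copy must avoid, given that [x] and [y]
    belong to the copy. *)
Definition collisions (n : nat) (c : {set 'I_n} -> nat) (x y : 'I_n) :
  {set 'I_n} := [set x; y] :|: rep_edge c (c [set x; y]).

(** The injection [h] is just a triple of distinct indices: [None] for the index
    subject to avoidance, [Some true] and [Some false] for the two others. *)
Definition generic (n : nat) (c : {set 'I_n} -> nat) (I : finType)
    (f : {ffun I -> 'I_n}) : bool :=
  [forall h : {ffun option bool -> I}, injectiveb h ==>
     (f (h None) \notin collisions c (f (h (Some true))) (f (h (Some false))))].

Lemma generic_notin (n : nat) (c : {set 'I_n} -> nat) (I : finType)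
    (f : {ffun I -> 'I_n}) (i j l : I) :
  generic c f -> l != i -> l != j -> i != j ->
  f l \notin collisions c (f i) (f j).
Proof.
move=> /forallP gen li lj ij.
pose h : {ffun option bool -> I} :=
  [ffun o => if o is Some b then (if b then i else j) else l].
have inj_h : injectiveb h.
  apply/injectiveP=> o o'; rewrite !ffunE.
  by case: o o' => [[]|] [[]|] // eq_io; move: li lj ij; rewrite eq_io eqxx.
by have /implyP/(_ inj_h) := gen h; rewrite !ffunE.
Qed.

Lemma generic_inj (n : nat) (c : {set 'I_n} -> nat) (I : finType)
    (f : {ffun I -> 'I_n}) : 2 < #|I| -> generic c f -> injective f.
Proof.
move=> I3 gen i l fil; apply/eqP; apply: contraT => il.
have /card_gt0P[j] : 0 < #|~: [set i; l]|.
  by rewrite cardsCs setCK cards2 il subn_gt0.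
rewrite !inE negb_or => /andP[ji jl].
have li : l != i by rewrite eq_sym.
have lj : l != j by rewrite eq_sym.
have ij : i != j by rewrite eq_sym.
by have := generic_notin gen li lj ij; rewrite /collisions !inE fil eqxx.
Qed.

(** For a fixed triple of indices, the images of the last two determine at most 4
    forbidden values for the first, which costs one factor [n]. *)
Lemma card_nongeneric (n : nat) (c : {set 'I_n} -> nat) (I : finType) :
  2 < #|I| ->
  #|[set f : {ffun I -> 'I_n} | ~~ generic c f]|
    <= #|I| ^ 3 * (4 * n ^ #|I|.-1).
Proof.
move=> I3.
have -> : #|I| ^ 3 = #|{ffun option bool -> I}|.
  by rewrite card_ffun card_option card_bool.
pose P (g : {ffun option bool -> 'I_n}) :=
  g None \in collisions c (g (Some true)) (g (Some false)).
apply: (@card_union_bound _ _ _ (fun h : {ffun option bool -> I} => injectiveb h)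
  (fun h : {ffun option bool -> I} =>
    [set f : {ffun I -> 'I_n} | P [ffun o => f (h o)]])) => [f | h].
  rewrite inE => /forallPn[h]; rewrite negb_imply negbK => /andP[inj_h hP].
  by exists h => //; rewrite inE /P !ffunE.
move/injectiveP=> inj_h.
rewrite (card_ffun_restrict P inj_h) card_option card_bool card_ord.
have -> : #|I|.-1 = 2 + (#|I| - 3) by lia.
rewrite expnD mulnA leq_mul2r; apply/orP; right.
pose Q v (g : {ffun bool -> 'I_n}) := v \in collisions c (g true) (g false).
have -> : #|[set g | P g]| = \sum_g #|[set v | Q v g]|.
  rewrite -card_ffun_option; apply: eq_card => g.
  by rewrite inE [RHS]inE /P /Q !ffunE.
have -> : n ^ 2 = #|{ffun bool -> 'I_n}| by rewrite card_ffun card_bool card_ord.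
rewrite mulnC -sum_nat_const; apply: leq_sum => g _; rewrite cardsE.
apply: leq_trans (leq_card_setU _ _) _; rewrite (leq_add (n1 := 2)) //.
  by rewrite cards2; case: (_ != _).
exact: card_rep_edge.
Qed.

Lemma copy_edges_complete (T : finType) (p : nat) (h : complete_graph p -> T) e :
  e \in copy_edges h -> exists i j, i != j /\ e = [set h i; h j].
Proof.
case/imsetP=> e'; rewrite inE => /cards2P[i [j [ij ->]]] ->.
by exists i, j; rewrite imset_pair.
Qed.

Lemma card_spanned_graph (T : finType) (E : {set {set T}}) :
  #|spanned_graph E| = #|cover E|.
Proof. by rewrite card_sig; apply: eq_card. Qed.

(** If a representative edge [e1] occurs in the copy, any edge [e] of the copy
    with the colour of [e1] has [e1] as its representative; genericity forces
    the ends of [e1] to be those of [e].  So a colour class containing a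
    representative is a single edge, and any other class stays inside the part
    of size [k]. *)
Lemma generic_blowup_copy (n k q : nat) (c : {set 'I_n} -> nat)
    (f : {ffun 'I_k + 'I_q -> 'I_n}) :
  2 <= k -> 0 < q -> generic c f -> blowup_map (rep_edges c) f ->
  exists2 h : complete_graph (k + q) -> 'I_n, injective h &
    forall e0, e0 \in copy_edges h ->
      at_most_vertices k (color_class c (copy_edges h) (c e0)).
Proof.
move=> k2 q0 gen /andP[/clique_mapP clB /forallP clAB].
have inj_f : injective f.
  by apply: generic_inj gen; rewrite card_sum !card_ord; lia.
pose h (i : complete_graph (k + q)) : 'I_n := f (split (i : 'I_(k + q))).
have inj_h : injective h.
  by move=> i j /inj_f; apply: (can_inj (@splitK k q)).
have copyP e : e \in copy_edges h -> exists i j, i != j /\ e = [set f i; f j].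
  case/copy_edges_complete=> i [j [ij ->]].
  exists (split (i : 'I_(k + q))), (split (j : 'I_(k + q))); split=> //.
  by rewrite (inj_eq (can_inj (@splitK k q))).
exists h => // e0 e0h.
rewrite /at_most_vertices /color_class card_spanned_graph.
set C := [set e in _ | _].
have [/exists_inP[e1 e1C e1R] | /exists_inPn noR] :=
  boolP [exists e1 in C, e1 \in rep_edges c].
  have [a [b [ab e1E]]] : exists a b, a != b /\ e1 = [set f a; f b].
    by move: e1C; rewrite inE => /andP[/copyP].
  suff sC : C \subset [set e1].
    apply: leq_trans k2; rewrite (leq_trans (n := #|e1|)) //.
      apply/subset_leq_card/bigcupsP=> e /(subsetP sC).
      by rewrite inE => /eqP->.
    by rewrite e1E cards2; case: (_ != _).
  apply/subsetP=> e eC; rewrite inE.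
  have [i [j [ij eE]]] : exists i j, i != j /\ e = [set f i; f j].
    by move: eC; rewrite inE => /andP[/copyP].
  have rep_e : rep_edge c (c e) = e1.
    rewrite -(rep_edgesK e1R); congr (rep_edge c _).
    by move: e1C eC; rewrite !inE => /andP[_ /eqP->] /andP[_ /eqP].
  have mem_e1 l : f l \in e1 -> (l == i) || (l == j).
    move=> fl; apply: contraLR fl; rewrite negb_or => /andP[li lj].
    have := generic_notin gen li lj ij.
    by rewrite /collisions -eE rep_e inE negb_or => /andP[].
  have := mem_e1 a; have := mem_e1 b; rewrite e1E !inE !eqxx orbT => /(_ isT) bij /(_ isT) aij.
  rewrite eE; move: bij aij ab => /orP[]/eqP-> /orP[]/eqP->; rewrite ?eqxx //.
  by rewrite setUC.
have sC : cover C \subset [set f (inl a) | a in 'I_k].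
  apply/subsetP=> x /bigcupP[e eC xe].
  have := noR e eC; have [i [j [ij eE]]] : exists i j, i != j /\ e = [set f i; f j].
    by move: eC; rewrite inE => /andP[/copyP].
  move: xe ij; rewrite eE; case: i {eE} => [a|b]; case: j => [a'|b'] xe ij.
  - by move: xe; rewrite !inE => /orP[]/eqP-> _; apply: imset_f.
  - by have /forallP-> := clAB a.
  - by rewrite setUC; have /forallP-> := clAB a'.
  - by rewrite clB.
apply: leq_trans (subset_leq_card sC) _.
by apply: leq_trans (leq_imset_card _ _) _; rewrite card_ord.
Qed.

(** * Bounds on the colour number *)

(** Blow-up maps are at least a fixed fraction of all maps, while nongeneric ones
    are a fraction [O(1 / n)]; the bound on [n] makes the former outnumber the
    latter. *)
Lemma many_colors_force_copy (n k q s : nat) :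
  let m := 2 * s + q.+1 in
  2 <= k -> 0 < q ->
  m + (2 * m ^ q.+3) ^ k * ((k + q) ^ 3 * 4) < n ->
  forall c : {set 'I_n} -> nat,
    s * turan n (complete_graph q.+1) + n ^ 2 <= s * num_colors c ->
    exists2 h : complete_graph (k + q) -> 'I_n, injective h &
      forall e0, e0 \in copy_edges h ->
        at_most_vertices k (color_class c (copy_edges h) (c e0)).
Proof.
move=> m k2 q0 big_n c many.
have sE := rep_edges_pairs c.
have mn : m <= n by apply: ltnW; apply: leq_ltn_trans big_n; apply: leq_addr.
have n0 : 0 < n by apply: leq_ltn_trans big_n.
have sm : 2 * s < m by rewrite /m addnS ltnS leq_addr.
have qm : q < m by rewrite /m leq_addl.
have dense := leq_trans many (leq_mul (leqnn s) (leq_num_colors_rep c)).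
have := many_cliques sm qm q0 mn sE dense.
have card_n : #|'I_n| = n := card_ord n.
move: (@blowup_count 'I_n (rep_edges c) k q (m ^ q.+3)); rewrite card_n.
move=> blow /(blow (ltnW k2) n0) {blow}.
set W := [set f | _] => leW.
have [/exists_inP[f fW gen] | /exists_inPn nogen] := boolP [exists f in W, generic c f].
  by apply: generic_blowup_copy gen _ => //; move: fW; rewrite inE.
have sW : W \subset [set f : {ffun 'I_k + 'I_q -> 'I_n} | ~~ generic c f].
  by apply/subsetP=> f /nogen; rewrite inE.
have I3 : 2 < #|{: 'I_k + 'I_q}| by rewrite card_sum !card_ord; lia.
have := leq_trans (subset_leq_card sW) (card_nongeneric c I3).
rewrite card_sum !card_ord => leN.
have := leq_trans leW (leq_mul (leqnn _) leN).
have -> : n ^ (k + q) = n * n ^ (k + q).-1 by rewrite -expnS prednK // addn_gt0 q0 orbT.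
rewrite !mulnA leq_pmul2r ?expn_gt0 ?n0 // => le_n.
have := leq_trans big_n le_n; rewrite -!mulnA ltnNge leq_addl; by [].
Qed.

Lemma color_number_leq (n k q s : nat) :
  2 <= k -> 0 < q -> 0 < s ->
  (2 * s + q.+1) + (2 * (2 * s + q.+1) ^ q.+3) ^ k * ((k + q) ^ 3 * 4) < n ->
  color_number n (complete_graph (k + q)) (at_most_vertices k)
    <= turan n (complete_graph q.+1) + (n ^ 2 %/ s).+1.
Proof.
move=> k2 q0 s0 big_n; rewrite /color_number; case: ex_minnP => m0 _; apply.
apply/boolp.asboolP=> c many; apply: (@many_colors_force_copy n k q s) => //.
apply: leq_trans (leq_mul (leqnn s) many); rewrite mulnDr leq_add2l.
by rewrite ltnW // mulnC ltn_ceil.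
Qed.

(** The vertices missed by colour 0 are joined by [E] to everything in the copy, so
    one vertex met by colour 0 can be added to the clique that they form. *)
Lemma turan_lt_color_number (n k q : nat) : 0 < k -> 0 < q ->
  turan n (complete_graph q.+1)
    < color_number n (complete_graph (k + q)) (at_most_vertices k).
Proof.
move=> k0 q0; have [E [sE fE <-]] := @turan_attained n q.+1 q0.
rewrite /color_number; case: ex_minnP => m /boolp.asboolP forced _.
rewrite ltnNge; apply: contra fE => leE.
pose c (e : {set 'I_n}) := if e \in E then (index e (enum E)).+1 else 0.
have cE0 e : c e = 0 -> e \notin E by rewrite /c; case: (e \in E).
have colE : #|E| <= num_colors c.
  rewrite cardE -(size_map c); apply: uniq_leq_size.
    rewrite map_inj_in_uniq ?enum_uniq // => e e'; rewrite !mem_enum => eE e'E.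
    rewrite /c eE e'E => -[eq_i]; rewrite -[e](nth_index set0 (s := enum E)) ?mem_enum //.
    by rewrite eq_i nth_index ?mem_enum.
  move=> _ /mapP[e eE ->]; rewrite mem_undup; apply: image_f.
  by apply: (subsetP sE); rewrite -mem_enum.
have [h inj_h hc] := forced c (leq_trans leE colE).
pose C0 := [set e in copy_edges h | c e == 0].
have leZ : #|cover C0| <= k.
  have [-> | [e0 e0C]] := set_0Vmem C0; first by rewrite /cover big_set0 cards0.
  have := e0C; rewrite inE => /andP[/hc + /eqP c0].
  by rewrite /at_most_vertices /color_class card_spanned_graph c0.
pose X := [set i | h i \notin cover C0].
have leX : q <= #|X|.
  have leXC : #|~: X| <= k.
    apply: leq_trans leZ; rewrite -(card_imset _ inj_h); apply: subset_leq_card.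
    by apply/subsetP=> _ /imsetP[i + ->]; rewrite !inE negbK.
  by have := cardsC X; rewrite card_ord; lia.
have clX i j : i \in X -> i != j -> [set h i; h j] \in E.
  rewrite inE => iX ij; apply: contraR iX => nE; apply/bigcupP.
  exists [set h i; h j]; last by rewrite !inE eqxx.
  rewrite inE /c (negPf nE) eqxx andbT -imset_pair; apply: imset_f.
  by rewrite inE cards2 ij.
have [Y leY clY] : exists2 Y : {set 'I_(k + q)}, q < #|Y| &
    {in Y &, forall i j, i != j -> [set h i; h j] \in E}.
  have [XT | /set0Pn[j]] := eqVneq (~: X) set0.
    exists setT; first by rewrite cardsT card_ord; lia.
    move=> i j _ _; apply: clX; by rewrite -[X]setCK XT setC0 inE.
  rewrite inE => jX; exists (j |: X); first by rewrite cardsU1 jX add1n ltnS.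
  move=> i l; rewrite !(in_setU1 _ j) => /orP[/eqP-> | iX _]; last exact: clX.
  move=> /orP[/eqP->|lX]; first by rewrite eqxx.
  by rewrite setUC eq_sym; apply: clX.
apply: (clique_map_copy (J := {i : 'I_(k + q) | i \in Y})
          (f := fun i => h (val i))) => //.
  by rewrite card_sig; apply: leq_trans leY _; rewrite cardE size_filter.
by apply/clique_mapP=> i j ij; apply: clY; rewrite ?(valP i) ?(valP j).
Qed.

(** By [turan_density] the single edge on two vertices, which contains no
    triangle, bounds the Turan density from below. *)
Lemma turan_quadratic (n q : nat) : 1 < q -> 1 < n ->
  n ^ 2 <= 8 * turan n (complete_graph q.+1).
Proof.
move=> q1 n1.
have t2 : 1 <= turan 2 (complete_graph q.+1).
  have := @leq_turan 2 (pairs 'I_2) (complete_graph q.+1) (subxx _).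
  rewrite card_draws card_ord binn; apply.
  apply/negP=> /copy_clique_map[f /(clique_map_inj (subxx _))/leq_card].
  by rewrite !card_ord ltnNge q1.
have := @turan_density n 2 q.+1 n1 (ltnW q1) isT.
have choose2 : 'C(n, 2) * 2 = n * n.-1 by rewrite mulnC -mul_bin_diag bin1.
rewrite mulnA choose2; nia.
Qed.

(** Of the constant 16, one half pays for the error [n ^ 2 / s], through
    [turan_quadratic], and the other half for rounding it up. *)
Lemma color_number_leq_scaled (n k q s : nat) :
  2 <= k -> 1 < q -> 0 < s -> s <= n ->
  (2 * s + q.+1) + (2 * (2 * s + q.+1) ^ q.+3) ^ k * ((k + q) ^ 3 * 4) < n ->
  s * color_number n (complete_graph (k + q)) (at_most_vertices k)
    <= (s + 16) * turan n (complete_graph q.+1).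
Proof.
move=> k2 q1 s0 sn big_n.
have up := color_number_leq k2 (ltnW q1) s0 big_n.
have n1 : 1 < n by apply: leq_ltn_trans big_n; rewrite !addnS.
have low := @turan_quadratic n q q1 n1.
apply: leq_trans (leq_mul (leqnn s) up) _.
rewrite mulnDr mulnDl leq_add2l mulnS.
have le1 : s <= n ^ 2 by apply: leq_trans sn _; rewrite leq_pmulr // ltnW.
have le2 : s * (n ^ 2 %/ s) <= n ^ 2 by rewrite mulnC leq_trunc_div.
lia.
Qed.

Import Order.TTheory GRing.Theory Num.Theory numFieldNormedType.Exports.
Local Open Scope classical_set_scope.
Local Open Scope ring_scope.

(** * The asymptotic formula *)

Theorem theorem4p11 (R : realType) (k p : nat) (hk : (2 <= k)%N)
    (hp : (k + 2 <= p)%N) :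
  exists2 eps : nat -> R, eps n @[n --> \oo] --> (0 : R) &
    \forall n \near \oo,
      (color_number n (complete_graph p) (at_most_vertices k))%:R =
      (1 + eps n) * (turan n (complete_graph (p - k + 1)))%:R.
Proof.
have [q q1 ->] : exists2 q, (1 < q)%N & p = (k + q)%N.
  by exists (p - k)%N; rewrite ?subnKC ?leq_subRL; lia.
have -> : (k + q - k + 1 = q.+1)%N by lia.
pose col n := color_number n (complete_graph (k + q)) (at_most_vertices k).
pose ex n := turan n (complete_graph q.+1).
have ex_gt0 n : (1 < n)%N -> (0 : R) < (ex n)%:R.
  by move=> n1; rewrite ltr0n; have := @turan_quadratic n q q1 n1; rewrite -/(ex n); nia.
exists (fun n => (col n)%:R / (ex n)%:R - 1); last first.
  exists 2%N => //= n n1.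
  by rewrite -/(col n) -/(ex n) addrC subrK divfK // gt_eqF ?ex_gt0.
apply/cvgr0Pnorm_lt => e e0.
pose s := (Num.bound (16 / e)).+1.
have se : 16 < s%:R * e.
  rewrite -ltr_pdivrMr //; apply: (@lt_le_trans _ _ (Num.bound (16 / e))%:R).
    by apply: archi_boundP; rewrite divr_ge0 // ltW.
  by rewrite ler_nat.
exists (2 + s + ((2 * s + q.+1) +
  (2 * (2 * s + q.+1) ^ q.+3) ^ k * ((k + q) ^ 3 * 4)))%N.+1 => // n /= big_n.
have n1 : (1 < n)%N by lia.
have ex0 := ex_gt0 n n1.
have lo : (ex n)%:R <= (col n)%:R :> R.
  rewrite ler_nat; apply: ltnW.
  by apply: turan_lt_color_number; [exact: ltnW | exact: ltnW].
have up : s%:R * (col n)%:R <= (s%:R + 16) * (ex n)%:R :> R.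
  rewrite -[16]/(16%:R) -natrD -!natrM ler_nat.
  by apply: color_number_leq_scaled => //; lia.
have s0 : (0 : R) < s%:R by rewrite ltr0n.
rewrite ger0_norm; last by rewrite subr_ge0 ler_pdivlMr // mul1r.
rewrite ltrBlDr ltr_pdivrMr // -(ltr_pM2l s0).
apply: le_lt_trans up _.
by rewrite mulrA ltr_pM2r // mulrDr mulr1 addrC ltrD2r.
Qed.
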